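(* Let $K$ be an oriented virtual knotoid and let $D$ be a virtual knotoid diagram representing $K$. Then the two-variable parity polynomial $$\mathbf{P}_D(x,y)=\sum_{c \in E(D)} \operatorname{sgn}(c)\, i(c)\, x^{W_D(c)} + \sum_{c \in O(D)} \operatorname{sgn}(c)\, i(c)\, y^{W_D(c)}\in\mathbb Z[x^{\pm1},y^{\pm1}]$$ is an invariant of $K$; that is, if $D$ and $D'$ are two diagrams of $K$ (related by a finite sequence of generalized Reidemeister moves), then $\mathbf{P}_D(x,y)=\mathbf{P}_{D'}(x,y)$.
   Context: **Virtual knotoids.** A knotoid diagram in $S^2$ is a generic immersion of $[0,1]$ into the oriented sphere $S^2$ with finitely many transverse double points, each endowed with over/under information (classical crossings). The images of $0$ and $1$ are the tail and the head; they are distinct from each other and from all crossings. The diagram is oriented from tail to head. A virtual knotoid diagram may also have virtual crossings (double points marked by a small circle, with no over/under information). A virtual knotoid is an equivalence class of virtual knotoid diagrams under isotopy and the generalized Reidemeister moves: the classical moves $\Omega_1,\Omega_2,\Omega_3$ (performed away from the endpoints); their analogues $\Omega_1^v,\Omega_2^v,\Omega_3^v$ with all crossings virtual; the mixed move $\Omega_3^m$ (a strand having virtual crossings with both strands of a classical crossing is moved across that classical crossing); and the move $\Omega_v$ (an endpoint is moved across a strand, creating or removing a virtual crossing). Moving an endpoint over or under a strand so as to create or remove a classical crossing is forbidden. **Sign.** Draw a classical crossing $c$ with both strands directed upward. Then $\operatorname{sgn}(c)=1$ if the over-strand goes from bottom left to top right, and $\operatorname{sgn}(c)=-1$ if the over-strand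 goes from bottom right to top left. $C(D)$ is the set of classical crossings of $D$. **Labels and weight.** Arcs are the segments of $D$ between consecutive crossings (or endpoints). Integer labels $\ell$ are assigned to arcs starting from the tail (initial label $0$): at a classical crossing drawn with both strands upward, the label increases by $1$ along the strand going from bottom right to top left and decreases by $1$ along the strand going from bottom left to top right (regardless of over/under); labels do not change at virtual crossings. If at $c$ the incoming arcs are $\alpha$ (bottom left) and $\beta$ (bottom right), the weight is $W_D(c)=\operatorname{sgn}(c)\big(\ell(\alpha)-(\ell(\beta)+1)\big)$. **Smoothing, parity, intersection index.** The orientation-preserving smoothing at $c$ (joining the bottom-left incoming arc to the top-left outgoing arc and the bottom-right incoming arc to the top-right outgoing arc) gives an ordered two-component diagram $D_1\cup D_2$: if $\operatorname{sgn}(c)=1$, $D_1$ is the component containing the left smoothed strand and $D_2$ the one containing the right smoothed strand; if $\operatorname{sgn}(c)=-1$, $D_1$ contains the right one and $D_2$ the left one. $I(c)$ is the number of classical crossings between $D_1$ and $D_2$; $c$ is even if $I(c)$ is even and odd otherwise. $E(D)$ and $O(D)$ are the sets of even and odd crossings of $D$. For a classical crossing $e$ between $D_1$ and $D_2$ put $\operatorname{ind}(e)=\operatorname{sgn}(e)$ if $D_1$ is the over-strand at $e$, and $\operatorname{ind}(e)=-\operatorname{sgn}(e)$ if $D_2$ is the over-strand at $e$. The intersection index is $i(c)=\sum_{e\in D_1\cap D_2}\operatorname{ind}(e)$, the sum over classical crossings between $D_1$ and $D_2$. *)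

(* Defs.v *)
From HB Require Import structures.
From mathcomp Require Import all_boot all_order all_algebra.
From Stdlib Require Import Relation_Operators.

Set Implicit Arguments.
Unset Strict Implicit.
Unset Printing Implicit Defensive.

Import GRing.Theory.
Local Open Scope ring_scope.

(* A virtual knotoid diagram in S^2 is encoded by the sequence of passes of the *)
(* strand through its crossings, read from the tail to the head, virtual        *)
(* crossings included. The image of the strand is a connected plane graph       *)
(* (crossings are 4-valent, the tail and the head univalent), so every face is  *)
(* a disc and the cyclic order of the edges at each crossing determines the     *)
(* diagram up to isotopy of the oriented sphere. That order is recorded by the  *)
(* field [lr], and realizability in S^2 is genus 0 (Euler's formula). The       *)
(* encoding remembers everything but the names of the crossings.                *)

Inductive layer := Over | Under | Virtual.

Definition layer_code (l : layer) : option bool :=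
  match l with Over => Some true | Under => Some false | Virtual => None end.
Definition layer_decode (o : option bool) : layer :=
  match o with Some true => Over | Some false => Under | None => Virtual end.
Lemma layer_codeK : cancel layer_code layer_decode.
Proof. by case. Qed.
HB.instance Definition _ := Equality.copy layer (can_type layer_codeK).

(* [lr p]: when the crossing [xing p] is drawn with both strands upward, this   *)
(* pass goes from bottom left to top right (if true) or from bottom right to    *)
(* top left (if false).                                                         *)
Record pass := Pass { xing : nat; lr : bool; lay : layer }.

Definition pass_at (w : seq pass) (k : nat) : pass :=
  nth (Pass 0 true Virtual) w k.

Definition crossings (w : seq pass) : seq nat := undup (map xing w).

Definition well_formed (w : seq pass) : bool :=
  all (fun x =>
    has (perm_eq [seq (lr p, lay p) | p <- w & xing p == x])
      [:: [:: (true, Over); (false, Under)];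
          [:: (true, Under); (false, Over)];
          [:: (true, Virtual); (false, Virtual)]])
    (crossings w).

Definition lr_pos (w : seq pass) (x : nat) : nat :=
  find (fun p => (xing p == x) && lr p) w.
Definition rl_pos (w : seq pass) (x : nat) : nat :=
  find (fun p => (xing p == x) && ~~ lr p) w.
Definition over_pos (w : seq pass) (x : nat) : nat :=
  find (fun p => (xing p == x) && (lay p == Over)) w.
Definition under_pos (w : seq pass) (x : nat) : nat :=
  find (fun p => (xing p == x) && (lay p == Under)) w.

(* Arc number k comes into pass number k (into the head if k = size w) and goes *)
(* out of pass number k - 1 (out of the tail if k = 0).                         *)
Notation arc w := 'I_(size w).+1.

(* An arc traversed forward (true) or backward (false).                         *)
Notation dart w := (arc w * bool)%type.

(* Follow the dart to its end and take the leftmost exit there, making a U-turn *)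
(* at the tail and at the head. The orbits are the boundaries of the faces,     *)
(* each lying to the left of its darts.                                         *)
Definition left_turn (w : seq pass) (d : dart w) : dart w :=
  let: (k, forward) := d in
  if forward then
    if k == size w :> nat then (k, false)
    else let p := pass_at w k in
      if lr p then (inord (rl_pos w (xing p)).+1, true)
      else (inord (lr_pos w (xing p)), false)
  else
    if k == 0%N :> nat then (k, true)
    else let p := pass_at w k.-1 in
      if lr p then (inord (rl_pos w (xing p)), false)
      else (inord (lr_pos w (xing p)).+1, true).

(* V + F = E + 2, the vertices being the crossings, the tail and the head.      *)
Definition genus0 (w : seq pass) : bool :=
  ((size (crossings w)).+2 + fcard (@left_turn w) predT == (size w).+1 + 2)%N.

Record diagram := Diagram {
  passes :> seq pass;
  diagram_well_formed : well_formed passes;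
  diagram_genus0 : genus0 passes
}.

Definition tip (w : seq pass) (d : dart w) : nat :=
  xing (pass_at w (if d.2 then d.1 : nat else d.1.-1)).

(* The darts [ds] run around a polygonal face, with distinct corners and with   *)
(* neither endpoint on its boundary.                                            *)
Definition face (w : seq pass) (ds : seq (dart w)) : bool :=
  [&& fcycle (@left_turn w) ds,
      all (fun d : dart w => 0 < d.1 < size w)%N ds
    & uniq (map (@tip w) ds)].

Definition arc_ends (w : seq pass) (d : dart w) : seq pass :=
  [:: pass_at w d.1.-1; pass_at w d.1].

Definition all_ends (P : pred layer) (w : seq pass) (ds : seq (dart w)) : bool :=
  all (fun d => all (fun p => P (lay p)) (arc_ends d)) ds.

Definition over_layer : pred layer := fun l => l == Over.
Definition virtual_layer : pred layer := fun l => l == Virtual.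
Definition classical_layer : pred layer := fun l => l != Virtual.

Definition remove (xs : seq nat) (w : seq pass) : seq pass :=
  [seq p <- w | xing p \notin xs].

Definition flip_arc (k : nat) (w : seq pass) : seq pass :=
  take k.-1 w ++ rev (take 2 (drop k.-1 w)) ++ drop k.+1 w.

(* Pushing a strand across the opposite corner of a triangular face exchanges,  *)
(* on each of the three strands, its two crossings with the other two strands.  *)
Definition flip_triangle (w : seq pass) (d1 d2 d3 : dart w) : seq pass :=
  flip_arc d1.1 (flip_arc d2.1 (flip_arc d3.1 w)).

Definition rename (f : nat -> nat) (w : seq pass) : seq pass :=
  [seq Pass (f (xing p)) (lr p) (lay p) | p <- w].

(* One direction of each move; the equivalence below supplies the inverses.     *)
Inductive move (w : seq pass) : seq pass -> Prop :=
| Isotopy f : injective f -> move w (rename f w)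
| Omega1 (d1 : dart w) : face [:: d1] -> all_ends classical_layer [:: d1] ->
    move w (remove [:: tip d1] w)
| Omega2 (d1 d2 : dart w) : face [:: d1; d2] -> all_ends over_layer [:: d1] ->
    move w (remove [:: tip d1; tip d2] w)
  (* d1 lies on the top strand. *)
| Omega3 (d1 d2 d3 : dart w) : face [:: d1; d2; d3] ->
    all_ends classical_layer [:: d1; d2; d3] -> all_ends over_layer [:: d1] ->
    move w (flip_triangle d1 d2 d3)
| Omega1v (d1 : dart w) : face [:: d1] -> all_ends virtual_layer [:: d1] ->
    move w (remove [:: tip d1] w)
| Omega2v (d1 d2 : dart w) : face [:: d1; d2] ->
    all_ends virtual_layer [:: d1; d2] ->
    move w (remove [:: tip d1; tip d2] w)
| Omega3v (d1 d2 d3 : dart w) : face [:: d1; d2; d3] ->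
    all_ends virtual_layer [:: d1; d2; d3] ->
    move w (flip_triangle d1 d2 d3)
  (* d1 lies on the moving strand; the opposite corner is the tip of d2. *)
| Omega3m (d1 d2 d3 : dart w) : face [:: d1; d2; d3] ->
    all_ends virtual_layer [:: d1] ->
    has (fun p => (xing p == tip d2) && classical_layer (lay p)) w ->
    move w (flip_triangle d1 d2 d3)
| Omega_v_tail : (0 < size w)%N -> lay (pass_at w 0) = Virtual ->
    move w (remove [:: xing (pass_at w 0)] w)
| Omega_v_head : (0 < size w)%N -> lay (pass_at w (size w).-1) = Virtual ->
    move w (remove [:: xing (pass_at w (size w).-1)] w).

Definition equivalent : diagram -> diagram -> Prop :=
  clos_refl_sym_trans diagram (fun D D' => move D D').

Record virtual_knotoid := VirtualKnotoid {
  represents : diagram -> Prop;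
  represents_class : exists D0, forall D, represents D <-> equivalent D0 D
}.

Definition classical_crossings (w : seq pass) : seq nat :=
  undup [seq xing p | p <- w & classical_layer (lay p)].

Definition sgn (w : seq pass) (c : nat) : int :=
  if over_pos w c == lr_pos w c then 1 else -1.

Definition label_step (p : pass) : int :=
  if lay p == Virtual then 0 else if lr p then -1 else 1.

Definition label (w : seq pass) (k : nat) : int :=
  \sum_(p <- take k w) label_step p.

Definition weight (w : seq pass) (c : nat) : int :=
  sgn w c * (label w (lr_pos w c) - (label w (rl_pos w c) + 1)).

(* [smooth_next w c i j]: after smoothing c, arc j directly follows arc i.      *)
Definition smooth_next (w : seq pass) (c : nat) (i j : arc w) : bool :=
  (j == (if i == lr_pos w c :> nat then rl_pos w c
         else if i == rl_pos w c :> nat then lr_pos w c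
         else i).+1 :> nat).

Definition smooth_component (w : seq pass) (c : nat) (i : arc w) : {set arc w} :=
  [set j | connect (fun a b => smooth_next c a b || smooth_next c b a) i j].

(* The left smoothed strand starts with the incoming arc at the bottom left.    *)
Definition left_component (w : seq pass) (c : nat) : {set arc w} :=
  smooth_component c (inord (lr_pos w c)).
Definition right_component (w : seq pass) (c : nat) : {set arc w} :=
  smooth_component c (inord (rl_pos w c)).

Definition D1 (w : seq pass) (c : nat) : {set arc w} :=
  if sgn w c == 1 then left_component w c else right_component w c.
Definition D2 (w : seq pass) (c : nat) : {set arc w} :=
  if sgn w c == 1 then right_component w c else left_component w c.

(* For e != c, the strands at e belong to the components of their incoming arcs.*)
Definition over_arc (w : seq pass) (e : nat) : arc w := inord (over_pos w e).
Definition under_arc (w : seq pass) (e : nat) : arc w := inord (under_pos w e).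

Definition D1_over_D2 (w : seq pass) (c e : nat) : bool :=
  (over_arc w e \in D1 w c) && (under_arc w e \in D2 w c).
Definition D2_over_D1 (w : seq pass) (c e : nat) : bool :=
  (over_arc w e \in D2 w c) && (under_arc w e \in D1 w c).

Definition between (w : seq pass) (c : nat) : seq nat :=
  [seq e <- classical_crossings w |
    (e != c) && (D1_over_D2 w c e || D2_over_D1 w c e)].

Definition num_between (w : seq pass) (c : nat) : nat := size (between w c).

Definition ind (w : seq pass) (c e : nat) : int :=
  if D1_over_D2 w c e then sgn w e else - sgn w e.

Definition intersection_index (w : seq pass) (c : nat) : int :=
  \sum_(e <- between w c) ind w c e.

Definition even_crossings (w : seq pass) : seq nat :=
  [seq c <- classical_crossings w | ~~ odd (num_between w c)].
Definition odd_crossings (w : seq pass) : seq nat :=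
  [seq c <- classical_crossings w | odd (num_between w c)].

(* Z[x^{+-1}, y^{+-1}] is viewed inside the field Q(x, y), the field of         *)
(* fractions of Z[x][y].                                                        *)
Definition Qxy : fieldType := {fraction {poly {poly int}}}.
Definition var_x : Qxy := tofrac ('X%:P : {poly {poly int}}).
Definition var_y : Qxy := tofrac ('X : {poly {poly int}}).

Definition parity_polynomial (w : seq pass) : Qxy :=
  \sum_(c <- even_crossings w)
     (sgn w c * intersection_index w c)%:~R * var_x ^ weight w c
  + \sum_(c <- odd_crossings w)
     (sgn w c * intersection_index w c)%:~R * var_y ^ weight w c.

(* Main.v *)
Require Import Defs.
From mathcomp Require Import all_boot all_order all_algebra.
From mathcomp Require Import zify ring.

(** The intersection index of a classical crossing is the opposite of its
    weight. Indeed D1 is the component of the smoothing that contains the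
    over-strand arriving at c, and every pass p through a classical crossing e
    that lies on D1 contributes minus the label step of p to the sum of the
    indices: crossings of D1 with itself cancel out, and the crossings with D2
    give exactly their indices. Hence i(c) is, up to the term of c itself, minus
    the total label variation along D1, and this is -W(c)
    ([intersection_indexE]). Each crossing of D1 with D2 contributes a sign, so
    c is odd exactly when W(c) is ([odd_num_between]). The polynomial is
    therefore a sum of sgn(c) f(W(c)), where f depends on the weight only and
    f(0) = 0 ([parity_polynomialE]).

    The weight is computed from the moment of c, the sum over its two passes of
    the label step times the label of the incoming arc:
    W(c) = - sgn(c) (1 + moment c) ([weight_moment]). In terms of the word, the
    moment adds up step(p) step(q) over the pairs of passes p before q with q at
    c, so the effect of a local modification of the word is easy to follow.

    - A virtual crossing has steps 0 and can be removed freely.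
    - The two consecutive passes of a kink have opposite steps. Removing them
      changes no other moment, and their own crossing has moment -1, that is,
      weight 0.
    - The two sides of a bigon are two such pairs. Its two crossings have
      opposite signs and moments of sum -2, hence equal weights, and their terms
      cancel.
    - Exchanging two consecutive passes p, q changes the moment of c by
      step(p) step(q) ([p is at c] - [q is at c]). Around a triangular face the
      products step(p) step(q), counted with the direction in which the arc is
      traversed, are the same for the three sides, unless exactly two of the
      three crossings are classical. The changes then telescope to 0 around the
      triangle ([flip_change_triangle]), while exactly two classical
      crossings is what no third Reidemeister move allows. *)

Set Implicit Arguments.
Unset Strict Implicit.
Unset Printing Implicit Defensive.

Import GRing.Theory.
Local Open Scope ring_scope.

(** * Passes of a well-formed word *)

Lemma pass_decomp (w : seq pass) (i : nat) : (i < size w)%N ->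
  w = take i w ++ pass_at w i :: drop i.+1 w.
Proof. by move=> lt_i; rewrite -(drop_nth _ lt_i) cat_take_drop. Qed.

Lemma find_unique (P : pred pass) (w : seq pass) (i : nat) :
  count P w = 1%N -> (i < size w)%N -> P (pass_at w i) -> find P w = i.
Proof.
move=> c1 lt_i Pi; move: c1; rewrite {1 2}(pass_decomp lt_i) count_cat /= Pi.
rewrite find_cat /= Pi addn0 size_take lt_i has_count => c1.
suff -> : count P (take i w) = 0%N by [].
lia.
Qed.

(** Counting is how the well-formedness of a word gets used: the passes
    through one crossing have one of three explicit lists of types, so counting
    any kind of passes through it is a computation. *)
Lemma crossing_types (w : seq pass) (x : nat) : well_formed w ->
    x \in crossings w ->
  exists2 t, t \in [:: [:: (true, Over); (false, Under)];
                       [:: (true, Under); (false, Over)];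
                       [:: (true, Virtual); (false, Virtual)]]
  & forall Q : pred (bool * layer),
      count (fun p => (xing p == x) && Q (lr p, lay p)) w = count Q t.
Proof.
move=> /allP wf /wf /hasP[t t_in] /permP same_count; exists t => // Q.
rewrite -same_count count_map count_filter; apply: eq_count => p /=.
exact: andbC.
Qed.

Lemma mem_crossings (w : seq pass) (i : nat) : (i < size w)%N ->
  xing (pass_at w i) \in crossings w.
Proof.
by move=> lt_i; rewrite mem_undup -(nth_map _ 0%N) // mem_nth ?size_map.
Qed.

Lemma mem_classical_crossings (w : seq pass) (c : nat) :
  (c \in classical_crossings w) =
  has (fun p => (xing p == c) && classical_layer (lay p)) w.
Proof.
rewrite mem_undup -has_pred1 has_map !has_count count_filter.
by congr (0 < _)%N; apply: eq_count.
Qed.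

Lemma classical_crossings_sub (w : seq pass) :
  {subset classical_crossings w <= crossings w}.
Proof.
move=> c; rewrite mem_classical_crossings mem_undup -has_pred1 has_map.
by apply: sub_has => p /andP[].
Qed.

Lemma count_lr (w : seq pass) (x : nat) (b : bool) : well_formed w ->
  x \in crossings w -> count (fun p => (xing p == x) && (lr p == b)) w = 1%N.
Proof.
move=> wf x_in; have [t + cnt] := crossing_types wf x_in.
rewrite (cnt (fun q => q.1 == b)) !inE.
by case: b => /or3P[] /eqP ->.
Qed.

Lemma count_passes (w : seq pass) (x : nat) : well_formed w ->
  x \in crossings w -> count (fun p => xing p == x) w = 2%N.
Proof.
move=> wf x_in; have [t + cnt] := crossing_types wf x_in.
rewrite (eq_count (a2 := fun p => (xing p == x) && predT (lr p, lay p))).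
  by rewrite cnt !inE => /or3P[] /eqP ->.
by move=> p; rewrite andbT.
Qed.

Lemma count_layer (w : seq pass) (c : nat) (l : layer) : well_formed w ->
  c \in classical_crossings w ->
  count (fun p => (xing p == c) && (lay p == l)) w = (l != Virtual).
Proof.
move=> wf c_in.
have [t + cnt] := crossing_types wf (classical_crossings_sub c_in).
rewrite (cnt (fun q => q.2 == l)).
move: c_in; rewrite mem_classical_crossings has_count.
rewrite (cnt (fun q => classical_layer q.2)) !inE.
by move=> + /or3P[] /eqP te; rewrite te //; case: l.
Qed.

Lemma pass_unique (w : seq pass) (i j : nat) : well_formed w ->
  (i < size w)%N -> (j < size w)%N ->
  xing (pass_at w i) = xing (pass_at w j) ->
  lr (pass_at w i) = lr (pass_at w j) -> i = j.
Proof.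
move=> wf lt_i lt_j xe le.
have c1 := count_lr (lr (pass_at w j)) wf (mem_crossings lt_j).
rewrite -(find_unique c1 lt_j) ?eqxx //.
by rewrite (find_unique c1 lt_i) // xe le !eqxx.
Qed.

Lemma lr_posP (w : seq pass) (x : nat) : well_formed w -> x \in crossings w ->
  [/\ (lr_pos w x < size w)%N, xing (pass_at w (lr_pos w x)) = x
    & lr (pass_at w (lr_pos w x))].
Proof.
move=> wf x_in.
have h : has (fun p => (xing p == x) && lr p) w.
  rewrite has_count (eq_count (a2 := fun p => (xing p == x) && (lr p == true))).
    by rewrite count_lr.
  by move=> p; rewrite eqb_id.
have /andP[/eqP xe l] := nth_find (Pass 0 true Virtual) h.
by split=> //; rewrite -has_find.
Qed.

Lemma rl_posP (w : seq pass) (x : nat) : well_formed w -> x \in crossings w ->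
  [/\ (rl_pos w x < size w)%N, xing (pass_at w (rl_pos w x)) = x
    & lr (pass_at w (rl_pos w x)) = false].
Proof.
move=> wf x_in.
have h : has (fun p => (xing p == x) && ~~ lr p) w.
  rewrite has_count.
  rewrite (eq_count (a2 := fun p => (xing p == x) && (lr p == false))).
    by rewrite count_lr.
  by move=> p; rewrite eqbF_neg.
have /andP[/eqP xe /negbTE l] := nth_find (Pass 0 true Virtual) h.
by split=> //; rewrite -has_find.
Qed.

Lemma over_posP (w : seq pass) (c : nat) : well_formed w ->
  c \in classical_crossings w ->
  [/\ (over_pos w c < size w)%N, xing (pass_at w (over_pos w c)) = c
    & lay (pass_at w (over_pos w c)) = Over].
Proof.
move=> wf c_in.
have h : has (fun p => (xing p == c) && (lay p == Over)) w.
  by rewrite has_count count_layer.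
have /andP[/eqP xe /eqP l] := nth_find (Pass 0 true Virtual) h.
by split=> //; rewrite -has_find.
Qed.

Lemma under_posP (w : seq pass) (c : nat) : well_formed w ->
  c \in classical_crossings w ->
  [/\ (under_pos w c < size w)%N, xing (pass_at w (under_pos w c)) = c
    & lay (pass_at w (under_pos w c)) = Under].
Proof.
move=> wf c_in.
have h : has (fun p => (xing p == c) && (lay p == Under)) w.
  by rewrite has_count count_layer.
have /andP[/eqP xe /eqP l] := nth_find (Pass 0 true Virtual) h.
by split=> //; rewrite -has_find.
Qed.

Lemma pass_lr_rl (w : seq pass) (x i : nat) : well_formed w ->
  x \in crossings w -> (i < size w)%N -> xing (pass_at w i) = x ->
  i = if lr (pass_at w i) then lr_pos w x else rl_pos w x.
Proof.
move=> wf x_in lt_i xe.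
have [lt_l xl ll] := lr_posP wf x_in; have [lt_r xr rr] := rl_posP wf x_in.
by case: ifP => li; apply: (pass_unique wf) => //; rewrite ?xl ?xr ?li.
Qed.

Lemma lr_neq_rl (w : seq pass) (x : nat) : well_formed w -> x \in crossings w ->
  lr_pos w x != rl_pos w x.
Proof.
move=> wf x_in; have [_ _ ll] := lr_posP wf x_in.
by have [_ _ rr] := rl_posP wf x_in; apply: contraL ll => /eqP ->; rewrite rr.
Qed.

Lemma over_neq_under (w : seq pass) (c : nat) : well_formed w ->
  c \in classical_crossings w -> over_pos w c != under_pos w c.
Proof.
move=> wf c_in; have [_ _ lo] := over_posP wf c_in.
have [_ _ lu] := under_posP wf c_in.
by apply/eqP => oue; move: lu; rewrite -oue lo.
Qed.

Variant crossing_sign_spec (w : seq pass) (c : nat) : int -> Prop :=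
| PositiveCrossing of over_pos w c = lr_pos w c & under_pos w c = rl_pos w c :
    crossing_sign_spec w c 1
| NegativeCrossing of over_pos w c = rl_pos w c & under_pos w c = lr_pos w c :
    crossing_sign_spec w c (-1).

Lemma crossing_signP (w : seq pass) (c : nat) : well_formed w ->
  c \in classical_crossings w -> crossing_sign_spec w c (sgn w c).
Proof.
move=> wf c_in; have x_in := classical_crossings_sub c_in.
have [lt_o xo _] := over_posP wf c_in; have [lt_u xu _] := under_posP wf c_in.
have neq := over_neq_under wf c_in; have neq' := lr_neq_rl wf x_in.
rewrite /sgn; have [oe|one] := eqVneq (over_pos w c).
  constructor=> //; move: (pass_lr_rl wf x_in lt_u xu) neq.
  by case: ifP => // _ ->; rewrite oe eqxx.
have oe : over_pos w c = rl_pos w c.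
  by move: (pass_lr_rl wf x_in lt_o xo) one; case: ifP => // _ ->; rewrite eqxx.
constructor=> //; move: (pass_lr_rl wf x_in lt_u xu) neq.
by case: ifP => // _ ->; rewrite oe eqxx.
Qed.

(** The sign of a classical crossing can be read off its passes without
    their positions, which makes its invariance under the moves evident. *)
Lemma sgn_has (w : seq pass) (c : nat) : well_formed w ->
  c \in classical_crossings w ->
  sgn w c =
  if has (fun p => [&& xing p == c, lr p & lay p == Over]) w then 1 else -1.
Proof.
move=> wf c_in; have x_in := classical_crossings_sub c_in.
have [lt_o xo lo] := over_posP wf c_in.
have [lt_l xl ll] := lr_posP wf x_in.
have [_ _ lr_rl] := rl_posP wf x_in.
have over_lr : lr (pass_at w (over_pos w c)) =
    has (fun p => [&& xing p == c, lr p & lay p == Over]) w.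
  apply/idP/(has_nthP (Pass 0 true Virtual)) => [l|[i lt_i]].
    by exists (over_pos w c); rewrite // -/(pass_at w _) xo lo l !eqxx.
  move=> /and3P[/eqP xi li /eqP oi].
  suff -> : over_pos w c = i by [].
  apply: find_unique => //; first by rewrite count_layer.
  by rewrite /pass_at xi oi !eqxx.
rewrite -over_lr; case: (crossing_signP wf c_in) => -> _; first by rewrite ll.
by rewrite lr_rl.
Qed.

Lemma classical_pass (w : seq pass) (i : nat) : (i < size w)%N ->
  lay (pass_at w i) != Virtual -> xing (pass_at w i) \in classical_crossings w.
Proof.
move=> lt_i ci; rewrite mem_classical_crossings.
apply/(has_nthP (Pass 0 true Virtual)); exists i => //.
by rewrite -/(pass_at w i) eqxx.
Qed.

Lemma virtual_pass (w : seq pass) (i : nat) : well_formed w -> (i < size w)%N ->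
  lay (pass_at w i) = Virtual ->
  xing (pass_at w i) \notin classical_crossings w.
Proof.
move=> wf lt_i vi; apply/negP => /(count_layer Virtual wf) /=.
apply/eqP; rewrite -lt0n -has_count; apply/(has_nthP (Pass 0 true Virtual)).
by exists i; rewrite // -/(pass_at w i) vi !eqxx.
Qed.

(** * Labels, weights and moments *)

(** The label step and the incoming label multiplied, over all passes through
    crossings in C. As the label is itself a sum of steps, this is a quadratic
    form in the steps, whose variation under local changes of the word is
    explicit. Sets of crossings are allowed because the two crossings of a bigon
    are best treated together. *)
Definition moment (C : pred nat) (w : seq pass) : int :=
  \sum_(j < size w | C (xing (pass_at w j)))
    label_step (pass_at w j) * label w j.

Lemma step_over (w : seq pass) (c : nat) : well_formed w ->
  c \in classical_crossings w ->
  label_step (pass_at w (over_pos w c)) = - sgn w c.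
Proof.
move=> wf c_in; have [_ _ lo] := over_posP wf c_in; rewrite /label_step lo /=.
have [_ _ ll] := lr_posP wf (classical_crossings_sub c_in).
have [_ _ lr_rl] := rl_posP wf (classical_crossings_sub c_in).
by case: (crossing_signP wf c_in) => -> _; rewrite ?ll ?lr_rl ?opprK.
Qed.

Lemma step_under (w : seq pass) (c : nat) : well_formed w ->
  c \in classical_crossings w ->
  label_step (pass_at w (under_pos w c)) = sgn w c.
Proof.
move=> wf c_in; have [_ _ lo] := under_posP wf c_in; rewrite /label_step lo /=.
have [_ _ ll] := lr_posP wf (classical_crossings_sub c_in).
have [_ _ lr_rl] := rl_posP wf (classical_crossings_sub c_in).
by case: (crossing_signP wf c_in) => _ ->; rewrite ?ll ?lr_rl ?opprK.
Qed.

Lemma sgn_sqr (w : seq pass) (c : nat) : sgn w c * sgn w c = 1.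
Proof. by rewrite /sgn; case: ifP. Qed.

Lemma labelS (w : seq pass) (k : nat) : (k < size w)%N ->
  label w k.+1 = label w k + label_step (pass_at w k).
Proof.
move=> lt_k; rewrite /label (take_nth (Pass 0 true Virtual)) // big_rcons /=.
by rewrite addrC.
Qed.

Lemma label_sum (w : seq pass) (k : nat) : (k <= size w)%N ->
  label w k = \sum_(j < k) label_step (pass_at w j).
Proof.
elim: k => [|k IHk] le_k; first by rewrite /label take0 big_nil big_ord0.
by rewrite labelS // IHk ?big_ord_recr // ltnW.
Qed.

Lemma sum_at_crossing (w : seq pass) (c : nat) (F : nat -> int) :
    well_formed w -> c \in classical_crossings w ->
  \sum_(j < size w | xing (pass_at w j) == c) F j =
  F (over_pos w c) + F (under_pos w c).
Proof.
move=> wf c_in; have [lt_o xo _] := over_posP wf c_in.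
have [lt_u xu _] := under_posP wf c_in.
rewrite (bigD1 (Ordinal lt_o)) ?xo //= (bigD1 (Ordinal lt_u)) /=; last first.
  by rewrite xu eqxx eq_sym -val_eqE /= over_neq_under.
rewrite big_pred0 ?addr0 // => j; rewrite -!val_eqE /=.
have [/eqP xj|] := boolP (xing (pass_at w j) == c); last by [].
have x_in := classical_crossings_sub c_in.
rewrite (pass_lr_rl wf x_in (ltn_ord j) xj).
by case: (crossing_signP wf c_in) => -> ->; case: ifP; rewrite eqxx ?andbF.
Qed.

(** The over-pass and the under-pass of a classical crossing c have
    steps - sgn c and sgn c, and virtual passes have step 0. *)
Lemma sum_by_crossing (w : seq pass) (F : nat -> int) : well_formed w ->
  \sum_(j < size w) label_step (pass_at w j) * F j =
  \sum_(c <- classical_crossings w)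
     sgn w c * (F (under_pos w c) - F (over_pos w c)).
Proof.
move=> wf; transitivity (\sum_(c <- classical_crossings w)
    \sum_(j < size w | xing (pass_at w j) == c) label_step (pass_at w j) * F j).
  rewrite (exchange_big_dep predT) //=; apply: eq_bigr => j _.
  have [vj|cj] := eqVneq (lay (pass_at w j)) Virtual.
    by rewrite big1 /label_step ?vj ?mul0r.
  have x_in : xing (pass_at w j) \in classical_crossings w.
    rewrite mem_classical_crossings; apply/(has_nthP (Pass 0 true Virtual)).
    by exists j; rewrite // -/(pass_at w j) eqxx.
  rewrite (eq_bigl (pred1 (xing (pass_at w j)))) => [|c]; last exact: eq_sym.
  by rewrite -big_filter filter_pred1_uniq ?undup_uniq ?big_seq1.
rewrite !big_seq; apply: eq_bigr => c c_in.
rewrite (sum_at_crossing (fun j => label_step (pass_at w j) * F j)) //.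
by rewrite step_over // step_under //; ring.
Qed.

(** Each crossing is passed once in each direction, and the two steps are
    opposite. *)
Lemma label_head (w : seq pass) : well_formed w -> label w (size w) = 0.
Proof.
move=> wf; rewrite label_sum //.
under eq_bigr do rewrite -[label_step _]mulr1.
by rewrite (sum_by_crossing (fun=> 1)) // big1 // => c _; rewrite subrr mulr0.
Qed.

Lemma weightE (w : seq pass) (c : nat) : well_formed w ->
  c \in classical_crossings w ->
  weight w c = label w (over_pos w c) - label w (under_pos w c) - sgn w c.
Proof.
move=> wf c_in; rewrite /weight; case: (crossing_signP wf c_in) => -> ->; ring.
Qed.

Lemma weight_moment (w : seq pass) (c : nat) : well_formed w ->
  c \in classical_crossings w ->
  weight w c = - sgn w c * (1 + moment (pred1 c) w).
Proof.
move=> wf c_in; rewrite weightE // /moment /=.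
rewrite (sum_at_crossing (fun j => label_step (pass_at w j) * label w j)) //.
rewrite step_over // step_under //.
transitivity (sgn w c * sgn w c * (label w (over_pos w c)
  - label w (under_pos w c)) - sgn w c); last by ring.
by rewrite sgn_sqr mul1r.
Qed.

(** * The components of a smoothing *)

(** The smoothing at c closes up the arcs strictly after the first pass
    through c, up to the arc that comes into the second pass. The other arcs
    form the component of the tail and the head. *)
Definition on_loop (w : seq pass) (c i : nat) : bool :=
  (minn (lr_pos w c) (rl_pos w c) < i <= maxn (lr_pos w c) (rl_pos w c))%N.

(** The successor relation preserves the set of arcs on the loop,
    and each of the two classes of arcs is connected. *)
Lemma smooth_componentE (w : seq pass) (c : nat) (b : bool)
    (j : 'I_(size w).+1) :
    well_formed w -> c \in crossings w ->
  (j \in smooth_component c (inord (if b then lr_pos w c else rl_pos w c))) =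
  (on_loop w c j == on_loop w c (if b then lr_pos w c else rl_pos w c)).
Proof.
move=> wf c_in; have [lt_l _ _] := lr_posP wf c_in.
have [lt_r _ _] := rl_posP wf c_in; have neq := lr_neq_rl wf c_in.
set k := if b then _ else _.
have lt_k : (k < size w)%N by rewrite /k; case: (b).
have valk : (inord k : 'I_(size w).+1) = k :> nat by rewrite inordK // ltnW.
set e := fun i j : 'I_(size w).+1 => smooth_next c i j || smooth_next c j i.
have e_sym : connect_sym e by apply: sym_connect_sym => x y; rewrite /e orbC.
have step (x y : 'I_(size w).+1) : smooth_next c x y -> connect e x y.
  by move=> xy; apply: connect1; rewrite /e xy.
have inv : closed e [pred x : 'I_(size w).+1 | on_loop w c x == on_loop w c k].
  suff next (x y : 'I_(size w).+1) :
      smooth_next c x y -> on_loop w c x = on_loop w c y.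
    by move=> x y /orP[] xy; rewrite !inE (next _ _ xy).
  rewrite /smooth_next /on_loop => /eqP ->.
  by case: eqP => [->|?]; [|case: eqP => [->|?]]; lia.
rewrite inE; apply/idP/idP => [/(closed_connect inv)|]; rewrite ?inE.
  by rewrite valk eqxx => <-.
(* Every arc of the loop runs forward to arc M, every other arc is connected
   to arc m: forward if it precedes c, backward through arc M.+1 otherwise. *)
pose m := minn (lr_pos w c) (rl_pos w c).
pose M := maxn (lr_pos w c) (rl_pos w c).
have [mE ME] : m = minn (lr_pos w c) (rl_pos w c) /\
    M = maxn (lr_pos w c) (rl_pos w c) by [].
have lt_M : (M < size w)%N by rewrite gtn_max lt_l.
have lt_m : (m < M)%N by rewrite /m /M; lia.
have next_plain i : (i < size w)%N -> i != m -> i != M ->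
    connect e (inord i) (inord i.+1).
  move=> lt_i im iM; apply: step.
  rewrite /smooth_next !inordK // ?ltnS 1?ltnW //.
  by case: ifP => [/eqP|/eqP ?]; [|case: ifP => [/eqP|/eqP ?]];
    rewrite ?eqxx //; lia.
have cross : connect e (inord m) (inord M.+1).
  apply: step; rewrite /smooth_next !inordK // ?ltnS; last by lia.
  by case: ifP => [/eqP|/eqP ?]; [|case: ifP => [/eqP|/eqP ?]];
    rewrite ?eqxx //; lia.
have run i d : (i + d <= size w)%N ->
   (forall l, (i <= l < i + d)%N -> l != m /\ l != M) ->
   connect e (inord i) (inord (i + d)).
  elim: d => [|d IHd] lt_d avoid; first by rewrite addn0 connect0.
  apply: (connect_trans (IHd _ _)) => [|l /andP[? ?]|]; first by lia.
    by apply: avoid; lia.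
  rewrite addnS; have [|? ?] := avoid (i + d)%N; first by lia.
  by apply: next_plain => //; lia.
have to_end i : (i <= size w)%N ->
    connect e (inord i) (inord (if on_loop w c i then M else m)).
  move=> le_i; case: ifPn; rewrite /on_loop -/m -/M => loop_i.
    by have := run i (M - i)%N; rewrite subnKC; [apply; lia|lia].
  have [le_im|lt_mi] := leqP i m.
    by have := run i (m - i)%N; rewrite subnKC //; apply; lia.
  rewrite e_sym (connect_trans cross) //.
  by have := run M.+1 (i - M.+1)%N; rewrite subnKC; [apply; lia|lia].
have lt_j : (j <= size w)%N by rewrite -ltnS.
move=> /eqP same; rewrite e_sym -[j]inord_val.
rewrite (connect_trans (to_end _ lt_j)) //.
by rewrite same e_sym to_end // ltnW.
Qed.

Lemma on_loop_neq (w : seq pass) (c : nat) : well_formed w ->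
  c \in classical_crossings w ->
  on_loop w c (under_pos w c) = ~~ on_loop w c (over_pos w c).
Proof.
move=> wf c_in; have := lr_neq_rl wf (classical_crossings_sub c_in).
rewrite /on_loop; case: (crossing_signP wf c_in) => -> ->; lia.
Qed.

(** Whatever the sign of c, D1 is the component of the arc that comes into the
    over-pass of c, since this arc is on the left exactly when c is positive. *)
Lemma mem_D1 (w : seq pass) (c : nat) (j : 'I_(size w).+1) : well_formed w ->
  c \in classical_crossings w ->
  (j \in D1 w c) = (on_loop w c j == on_loop w c (over_pos w c)).
Proof.
move=> wf c_in; rewrite /D1 /left_component /right_component.
have x_in := classical_crossings_sub c_in.
case: (crossing_signP wf c_in) => -> _ /=.
  exact: (smooth_componentE true).
exact: (smooth_componentE false).
Qed.

Lemma mem_D2 (w : seq pass) (c : nat) (j : 'I_(size w).+1) : well_formed w ->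
  c \in classical_crossings w -> (j \in D2 w c) = (j \notin D1 w c).
Proof.
move=> wf c_in; rewrite mem_D1 // /D2 /left_component /right_component.
have x_in := classical_crossings_sub c_in.
have := on_loop_neq wf c_in.
case: (crossing_signP wf c_in) => -> -> /= neq.
  by rewrite (smooth_componentE false) //= neq; do 2!case: on_loop.
by rewrite (smooth_componentE true) //= neq; do 2!case: on_loop.
Qed.

Definition on_D1 (w : seq pass) (c i : nat) : bool :=
  on_loop w c i == on_loop w c (over_pos w c).

Lemma D1_over_D2E (w : seq pass) (c e : nat) : well_formed w ->
  c \in classical_crossings w -> e \in classical_crossings w ->
  D1_over_D2 w c e = on_D1 w c (over_pos w e) && ~~ on_D1 w c (under_pos w e).
Proof.
move=> wf c_in e_in; have [lt_o _ _] := over_posP wf e_in.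
have [lt_u _ _] := under_posP wf e_in.
by rewrite /D1_over_D2 mem_D2 // !mem_D1 // !inordK // ltnW.
Qed.

Lemma D2_over_D1E (w : seq pass) (c e : nat) : well_formed w ->
  c \in classical_crossings w -> e \in classical_crossings w ->
  D2_over_D1 w c e = ~~ on_D1 w c (over_pos w e) && on_D1 w c (under_pos w e).
Proof.
move=> wf c_in e_in; have [lt_o _ _] := over_posP wf e_in.
have [lt_u _ _] := under_posP wf e_in.
by rewrite /D2_over_D1 mem_D2 // !mem_D1 // !inordK // ltnW.
Qed.

(** * The intersection index *)

Lemma sum_steps_below (w : seq pass) (k : nat) : (k <= size w)%N ->
  \sum_(j < size w) label_step (pass_at w j) * (j < k)%:R = label w k.
Proof.
move=> le_k; rewrite label_sum //.
rewrite (big_ord_widen _ (fun j => label_step (pass_at w j)) le_k).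
rewrite [RHS]big_mkcond; apply: eq_bigr => j _.
by case: ifP; rewrite (mulr1, mulr0).
Qed.

Lemma sum_steps_loop (w : seq pass) (c : nat) : well_formed w ->
    c \in crossings w ->
  \sum_(j < size w) label_step (pass_at w j) * (on_loop w c j)%:R =
  label w (maxn (lr_pos w c) (rl_pos w c)).+1
  - label w (minn (lr_pos w c) (rl_pos w c)).+1.
Proof.
move=> wf c_in; have [lt_l _ _] := lr_posP wf c_in.
have [lt_r _ _] := rl_posP wf c_in.
rewrite -!sum_steps_below ?gtn_max ?gtn_min ?lt_l ?lt_r //.
rewrite -sumrB; apply: eq_bigr => j _; rewrite -mulrBr; congr (_ * _).
rewrite !ltnS /on_loop ltnNge.
have : (minn (lr_pos w c) (rl_pos w c) <=
        maxn (lr_pos w c) (rl_pos w c))%N by lia.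
by case: leqP; case: leqP => //=; lia.
Qed.

(** A crossing e other than c contributes
    sgn e times ([over-pass on D1] - [under-pass on D1]) in all cases. This is
    minus the sum of the steps of the passes of e on D1, so the sum over all e
    is the label variation along D1, which also appears in the weight. *)
Lemma intersection_indexE (w : seq pass) (c : nat) : well_formed w ->
  c \in classical_crossings w -> intersection_index w c = - weight w c.
Proof.
move=> wf c_in; have x_in := classical_crossings_sub c_in.
have [lt_o _ _] := over_posP wf c_in; have [lt_u _ _] := under_posP wf c_in.
pose F j : int := (on_D1 w c j)%:R.
have -> : intersection_index w c =
    - (\sum_(j < size w) label_step (pass_at w j) * F j) - sgn w c.
  rewrite sum_by_crossing // (bigD1_seq c) ?undup_uniq //=.
  (* The term of c, which the intersection index leaves out, is - sgn c. *)
  have -> : F (over_pos w c) = 1 by rewrite /F /on_D1 eqxx.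
  have -> : F (under_pos w c) = 0.
    by rewrite /F /on_D1 on_loop_neq //; case: on_loop.
  rewrite sub0r mulrN1 opprD opprK addrAC subrr add0r -sumrN.
  rewrite /intersection_index /between big_filter big_mkcondr /=.
  rewrite big_seq_cond [RHS]big_seq_cond; apply: eq_bigr => e /andP[e_in _].
  rewrite /ind D1_over_D2E // D2_over_D1E // /F.
  by case: on_D1; case: on_D1 => /=; ring.
rewrite weightE // /F /on_D1.
(* The steps along the whole strand add up to 0, so the two components have
   opposite step sums. *)
have sum_I b : \sum_(j < size w) label_step (pass_at w j)
      * (on_loop w c j == b)%:R =
    (if b then 1 else -1) * (label w (maxn (lr_pos w c) (rl_pos w c)).+1
                             - label w (minn (lr_pos w c) (rl_pos w c)).+1).
  rewrite -sum_steps_loop //; case: b.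
    by rewrite mul1r; apply: eq_bigr => j _; rewrite eqb_id.
  rewrite mulN1r -sumrN -[RHS]add0r -[X in X + _](label_head wf) label_sum //.
  rewrite -big_split /=.
  by apply: eq_bigr => j _; case: on_loop => /=; ring.
have Lo := labelS lt_o; have Lu := labelS lt_u.
rewrite step_over // in Lo; rewrite step_under // in Lu.
rewrite {}sum_I {1}/on_loop.
have neq := lr_neq_rl wf x_in.
case: (crossing_signP wf c_in) Lo Lu => -> -> Lo Lu.
  case: (ltngtP (lr_pos w c) (rl_pos w c)) neq => // lt_lr _.
    by rewrite ltnn Lo Lu /=; ring.
  by rewrite lt_lr leqnn Lo Lu /=; ring.
case: (ltngtP (lr_pos w c) (rl_pos w c)) neq => // lt_lr _.
  by rewrite lt_lr leqnn Lo Lu /=; ring.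
by rewrite ltnn Lo Lu /=; ring.
Qed.

Lemma odd_sum_signs (T : Type) (s : seq T) (F : T -> int) :
  (forall e, F e = 1 \/ F e = -1) -> odd `|\sum_(e <- s) F e| = odd (size s).
Proof.
move=> sign; elim: s => [|e s IHs]; first by rewrite big_nil.
by rewrite big_cons /= -IHs; move: (\sum_(_ <- s) _) (sign e) => t [] ->; lia.
Qed.

Lemma odd_num_between (w : seq pass) (c : nat) : well_formed w ->
  c \in classical_crossings w -> odd (num_between w c) = odd `|weight w c|.
Proof.
move=> wf c_in; rewrite -abszN -intersection_indexE // odd_sum_signs // => e.
by rewrite /ind /sgn; do 2!case: ifP; rewrite ?opprK; auto.
Qed.

(** * The polynomial as a sum over weights *)

Definition crossing_term (s W : int) : Qxy :=
  (s * - W)%:~R * (if odd `|W| then var_y else var_x) ^ W.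

Lemma parity_polynomialE (w : seq pass) : well_formed w ->
  parity_polynomial w =
  \sum_(c <- classical_crossings w) crossing_term (sgn w c) (weight w c).
Proof.
move=> wf; rewrite /parity_polynomial !big_filter addrC.
rewrite [RHS](bigID (fun c => odd (num_between w c))) /=.
congr (_ + _); rewrite big_seq_cond [RHS]big_seq_cond;
  apply: eq_bigr => c /andP[c_in odd_c]; rewrite intersection_indexE //;
  rewrite /crossing_term -(odd_num_between wf c_in).
  by rewrite odd_c.
by rewrite (negbTE odd_c).
Qed.

Lemma crossing_term_opp (s W : int) :
  crossing_term (- s) W = - crossing_term s W.
Proof. by rewrite /crossing_term mulNr rmorphN mulNr. Qed.

Lemma crossing_term0 (s : int) : crossing_term s 0 = 0.
Proof. by rewrite /crossing_term oppr0 mulr0 mulr0z mul0r. Qed.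

(** What every move gives: outside a set xs of crossings
    that disappear, the signs and the moments are unchanged, while the terms of
    the crossings in xs cancel out. *)
Lemma parity_polynomial_moment (w w' : seq pass) (xs : seq nat) :
    well_formed w -> well_formed w' ->
    perm_eq (classical_crossings w')
            [seq c <- classical_crossings w | c \notin xs] ->
    {in classical_crossings w', forall c, sgn w' c = sgn w c} ->
    {in classical_crossings w', forall c,
      moment (pred1 c) w' = moment (pred1 c) w} ->
    \sum_(c <- classical_crossings w | c \in xs)
      crossing_term (sgn w c) (weight w c) = 0 ->
  parity_polynomial w = parity_polynomial w'.
Proof.
move=> wf wf' cc_w' sgn_w' moment_w' cancel.
rewrite !parity_polynomialE // (bigID (mem xs)) /= cancel add0r.
rewrite -big_filter -(perm_big _ cc_w') /= !big_seq.
apply: eq_bigr => c c_in; have := c_in; rewrite (perm_mem cc_w') mem_filter.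
move=> /andP[_ c_in']; rewrite !weight_moment //.
by rewrite sgn_w' ?moment_w'.
Qed.

(** * Local changes of the moment *)

Definition steps_at (C : pred nat) (w : seq pass) : int :=
  \sum_(p <- w | C (xing p)) label_step p.

Lemma moment_cat (C : pred nat) (u v : seq pass) :
  moment C (u ++ v) = moment C u + label u (size u) * steps_at C v + moment C v.
Proof.
rewrite /moment size_cat big_split_ord /= -addrA; congr (_ + _).
  apply: eq_big => j; rewrite /pass_at nth_cat ltn_ord // => _.
  by rewrite /label take_cat ltn_ord.
rewrite /steps_at (big_nth (Pass 0 true Virtual)) big_mkord big_distrr /=.
rewrite -big_split /=; apply: eq_big => j; rewrite /pass_at nth_cat.
  by rewrite ltnNge leq_addr addKn.
move=> _; rewrite ltnNge leq_addr addKn /= [X in X + _]mulrC -mulrDr.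
congr (_ * _).
by rewrite /label take_cat ltnNge leq_addr addKn big_cat take_size.
Qed.

Lemma moment_cons (C : pred nat) (p : pass) (w : seq pass) :
  moment C (p :: w) = label_step p * steps_at C w + moment C w.
Proof.
rewrite -cat1s moment_cat /= {1}/moment big1 ?add0r.
  by rewrite /label big_seq1.
by move=> j _; rewrite ord1 /label /= big_nil mulr0.
Qed.

Lemma steps_at_cons (C : pred nat) (p : pass) (w : seq pass) :
  steps_at C (p :: w) = (C (xing p))%:R * label_step p + steps_at C w.
Proof.
by rewrite /steps_at big_cons; case: (C _); rewrite ?mul1r // mul0r add0r.
Qed.

Lemma moment_swap (C : pred nat) (u v : seq pass) (p q : pass) :
  moment C (u ++ q :: p :: v) = moment C (u ++ p :: q :: v)
    + label_step p * label_step q * ((C (xing p))%:R - (C (xing q))%:R).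
Proof. by rewrite !moment_cat !moment_cons !steps_at_cons; ring. Qed.

(** A pair of consecutive passes with opposite steps leaves the labels
    after it unchanged, so only its own contribution to the moment is lost. *)
Lemma moment_delete (C : pred nat) (u v : seq pass) (p q : pass) :
    C (xing p) = C (xing q) -> label_step p + label_step q = 0 ->
  moment C (u ++ p :: q :: v) =
  moment C (u ++ v) + (C (xing p))%:R * (label_step p * label_step q).
Proof.
move=> Cpq /eqP; rewrite addr_eq0 => /eqP pq.
by rewrite !moment_cat !moment_cons !steps_at_cons -Cpq pq; ring.
Qed.

Lemma moment_none (C : pred nat) (w : seq pass) :
  ~~ has (fun p => C (xing p)) w -> moment C w = 0.
Proof.
move=> noC; rewrite /moment big_pred0 // => j; apply: contraNF noC => Cj.
by apply/(has_nthP (Pass 0 true Virtual)); exists j.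
Qed.

Lemma momentU (C C' : pred nat) (w : seq pass) :
  (forall x, ~~ (C x && C' x)) ->
  moment (fun x => C x || C' x) w = moment C w + moment C' w.
Proof.
move=> disj; rewrite /moment.
rewrite (bigID (fun j : 'I__ => C (xing (pass_at w j)))) /=.
by congr (_ + _); apply: eq_bigl => j; have := disj (xing (pass_at w j));
  case: (C _); case: (C' _).
Qed.

(** Passes with step 0 may be dropped, wherever they are. *)
Lemma moment_filter (C : pred nat) (a : pred pass) (w : seq pass) :
    all (fun p => a p || ~~ C (xing p) && (label_step p == 0)) w ->
  moment C (filter a w) = moment C w.
Proof.
move=> aw; suff [_ //] : steps_at C (filter a w) = steps_at C w /\
                         moment C (filter a w) = moment C w.
elim: w aw => [//|p w IHw] /= /andP[ap /IHw[IHs IHm]]; move: ap.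
case: ifP => _ /= => [_|/andP[/negbTE Cp /eqP p0]];
  by rewrite !moment_cons !steps_at_cons ?Cp ?p0 IHs IHm ?mul0r ?add0r.
Qed.

(** * Removal of crossings *)

Lemma removed_crossings (w : seq pass) (xs : seq nat) :
  classical_crossings (remove xs w) =
  [seq c <- classical_crossings w | c \notin xs].
Proof.
rewrite /classical_crossings /remove filter_undup filter_map; congr undup.
by rewrite -!filter_predI; congr map; apply: eq_filter => p; apply: andbC.
Qed.

Lemma sgn_remove (w : seq pass) (xs : seq nat) (c : nat) : well_formed w ->
  well_formed (remove xs w) -> c \in classical_crossings (remove xs w) ->
  sgn (remove xs w) c = sgn w c.
Proof.
move=> wf wf' c_in; rewrite !sgn_has //; last first.
  by move: c_in; rewrite removed_crossings mem_filter => /andP[].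
congr (if _ then _ else _); rewrite !has_count count_filter; congr (0 < _)%N.
apply: eq_count => p /=; case: eqP => //= ->.
by move: c_in; rewrite removed_crossings mem_filter => /andP[->]; rewrite andbT.
Qed.

Lemma parity_polynomial_remove (w : seq pass) (xs : seq nat) :
    well_formed w -> well_formed (remove xs w) ->
    (forall c, c \notin xs ->
      moment (pred1 c) (remove xs w) = moment (pred1 c) w) ->
    \sum_(c <- classical_crossings w | c \in xs)
      crossing_term (sgn w c) (weight w c) = 0 ->
  parity_polynomial w = parity_polynomial (remove xs w).
Proof.
move=> wf wf' mom; apply: parity_polynomial_moment => //.
- by rewrite removed_crossings.
- by move=> c; apply: sgn_remove.
by move=> c; rewrite removed_crossings mem_filter => /andP[/mom].
Qed.

Lemma parity_polynomial_remove_virtual (w : seq pass) (xs : seq nat) :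
    well_formed w -> well_formed (remove xs w) ->
    {in xs, forall x, x \notin classical_crossings w} ->
  parity_polynomial w = parity_polynomial (remove xs w).
Proof.
move=> wf wf' virt; apply: parity_polynomial_remove => // [c c_out|].
  apply: moment_filter; apply/(all_nthP (Pass 0 true Virtual)) => i lt_i.
  rewrite -/(pass_at w i); case: (boolP (_ \in xs)) => //= x_in.
  apply/andP; split; first by apply: contraNneq c_out => <-.
  rewrite /label_step ifT //; apply: contraNT (virt _ x_in).
  exact: classical_pass.
rewrite big_seq_cond big1 // => c /andP[c_in c_xs].
by have := virt c c_xs; rewrite c_in.
Qed.

(** * Darts around a face *)

(** The passes at the two ends of a dart, in the direction of travel: a dart
    runs from the pass at position [start_pos] to the one at [tip_pos]. *)
Definition start_pos (w : seq pass) (d : dart w) : nat :=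
  if d.2 then d.1.-1 else d.1.
Definition tip_pos (w : seq pass) (d : dart w) : nat :=
  if d.2 then d.1 : nat else d.1.-1.

(** A left turn changes to the other strand of the crossing at the tip,
    and continues in the same direction of travel precisely when the strand just
    left runs from bottom left to top right. *)
Lemma left_turn_inside (w : seq pass) (d d' : dart w) : well_formed w ->
    (0 < d.1 < size w)%N -> left_turn d = d' ->
  [/\ xing (pass_at w (start_pos d')) = tip d,
      lr (pass_at w (start_pos d')) = ~~ lr (pass_at w (tip_pos d))
    & d'.2 = (d.2 == lr (pass_at w (tip_pos d)))].
Proof.
case: d => k b wf /= /andP[k_gt0 lt_k] <-; rewrite /left_turn /tip /tip_pos /=.
have lt_k1 : (k.-1 < size w)%N by rewrite (leq_ltn_trans (leq_pred k)).
case: b.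
  rewrite ltn_eqF //.
  have [lt_l xl ll] := lr_posP wf (mem_crossings lt_k).
  have [lt_r xr lr_rl] := rl_posP wf (mem_crossings lt_k).
  by case: ifP => _; rewrite /start_pos /= inordK //= ltnS // ltnW.
rewrite gtn_eqF //.
have [lt_l xl ll] := lr_posP wf (mem_crossings lt_k1).
have [lt_r xr lr_rl] := rl_posP wf (mem_crossings lt_k1).
by case: ifP => _; rewrite /start_pos /= inordK //= ltnS // ltnW.
Qed.

Lemma start_pos_lt (w : seq pass) (d : dart w) :
  (0 < d.1 < size w)%N -> (start_pos d < size w)%N.
Proof. by rewrite /start_pos; case: d.2; lia. Qed.

Lemma tip_pos_lt (w : seq pass) (d : dart w) :
  (0 < d.1 < size w)%N -> (tip_pos d < size w)%N.
Proof. by rewrite /tip_pos; case: d.2; lia. Qed.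

Lemma virtual_dart (w : seq pass) (d : dart w) : well_formed w ->
    (0 < d.1 < size w)%N -> all_ends virtual_layer [:: d] ->
  tip d \notin classical_crossings w /\
  xing (pass_at w (start_pos d)) \notin classical_crossings w.
Proof.
move=> wf d_in; rewrite /all_ends /= !andbT => /andP[/eqP v1 /eqP v2].
split; apply: virtual_pass => //.
- exact: tip_pos_lt.
- by case: d.2.
- exact: start_pos_lt.
by rewrite /start_pos; case: d.2.
Qed.

(** Arcs k and l have no pass in common. *)
Definition apart (k l : nat) : bool := (k.+1 < l)%N || (l.+1 < k)%N.

Lemma darts_apart (w : seq pass) (d d' : dart w) :
    (0 < d.1)%N -> (0 < d'.1)%N ->
    start_pos d != start_pos d' -> start_pos d != tip_pos d' ->
    tip_pos d != start_pos d' -> tip_pos d != tip_pos d' ->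
  apart d.1 d'.1.
Proof.
case: d d' => k b [l b'] /=; rewrite /start_pos /tip_pos /apart /=.
by case: b; case: b'; lia.
Qed.

Lemma pos_neq (w : seq pass) (i j : nat) :
  xing (pass_at w i) != xing (pass_at w j) -> i != j.
Proof. by apply: contraNneq => ->. Qed.

Lemma lr_pos_neq (w : seq pass) (i j : nat) :
  lr (pass_at w j) = ~~ lr (pass_at w i) -> i != j.
Proof. by move=> ll; apply/eqP => ij; move: ll; rewrite ij; case: lr. Qed.

(** Two sides of a face that follow each other end at their common corner
    in the two different passes of that crossing. *)
Lemma turn_apart (w : seq pass) (d d' : dart w) : well_formed w ->
    (0 < d.1 < size w)%N -> (0 < d'.1 < size w)%N -> left_turn d = d' ->
    xing (pass_at w (start_pos d)) != tip d -> tip d != tip d' ->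
    start_pos d != tip_pos d' ->
  apart d.1 d'.1.
Proof.
move=> wf d_in d'_in dd' x_d x_d' sd.
have [x l _] := left_turn_inside wf d_in dd'.
case/andP: d_in => d_gt0 _; case/andP: d'_in => d'_gt0 _.
apply: darts_apart => //; last exact: (pos_neq x_d').
  by apply: (@pos_neq w); rewrite x.
exact: (lr_pos_neq l).
Qed.

Lemma arc_decomp (w : seq pass) (k : nat) : (0 < k < size w)%N ->
  w = take k.-1 w ++ pass_at w k.-1 :: pass_at w k :: drop k.+1 w.
Proof.
case: k => [//|k] /= lt_k; have lt_k' := ltnW lt_k.
by rewrite -(drop_nth _ lt_k) -(drop_nth _ lt_k') cat_take_drop.
Qed.

Lemma two_arcs_decomp (w : seq pass) (k l : nat) :
    (0 < k)%N -> (k.+1 < l)%N -> (l < size w)%N ->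
  exists u v z, w = u ++ pass_at w k.-1 :: pass_at w k
                    :: v ++ pass_at w l.-1 :: pass_at w l :: z.
Proof.
move=> k_gt0 lt_kl lt_l; have l_in : (0 < l < size w)%N by lia.
have k_in : (0 < k < size (take l.-1 w))%N by rewrite size_take; case: ifP; lia.
exists (take k.-1 (take l.-1 w)), (drop k.+1 (take l.-1 w)), (drop l.+1 w).
rewrite {1}(arc_decomp l_in) {1}(arc_decomp k_in) -catA /=.
by rewrite /pass_at !nth_take //; lia.
Qed.

(** * Triangle moves *)

Lemma flip_arcE (w : seq pass) (k : nat) : (0 < k < size w)%N ->
  flip_arc k w = take k.-1 w ++ pass_at w k :: pass_at w k.-1 :: drop k.+1 w.
Proof.
case: k => [//|k] /= lt_k; have lt_k' := ltnW lt_k; rewrite /flip_arc /=.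
rewrite (drop_nth (Pass 0 true Virtual) lt_k').
by rewrite (drop_nth (Pass 0 true Virtual) lt_k) /= take0.
Qed.

Lemma size_flip_arc (w : seq pass) (k : nat) : (0 < k < size w)%N ->
  size (flip_arc k w) = size w.
Proof.
by move=> k_in; rewrite flip_arcE // [in RHS](arc_decomp k_in) !size_cat.
Qed.

Lemma has_flip_arc (P : pred pass) (w : seq pass) (k : nat) :
  (0 < k < size w)%N -> has P (flip_arc k w) = has P w.
Proof.
move=> k_in; rewrite flip_arcE // [in RHS](arc_decomp k_in) !has_cat /=.
by congr (_ || _); rewrite orbCA.
Qed.

Lemma pass_at_flip_arc (w : seq pass) (k j : nat) : (0 < k < size w)%N ->
  j != k -> j != k.-1 -> pass_at (flip_arc k w) j = pass_at w j.
Proof.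
move=> k_in jk jk1; rewrite /pass_at flip_arcE //.
rewrite [in RHS](arc_decomp k_in) !nth_cat.
case: ifP => // le_j; rewrite size_take ifT in le_j *; last by lia.
by case e: (j - k.-1)%N => [|[|n]] //=; lia.
Qed.

(** The variation of the moment when the two passes at the ends of arc k are
    exchanged. *)
Definition flip_change (C : pred nat) (k : nat) (w : seq pass) : int :=
  label_step (pass_at w k.-1) * label_step (pass_at w k)
  * ((C (xing (pass_at w k.-1)))%:R - (C (xing (pass_at w k)))%:R).

Lemma moment_flip_arc (C : pred nat) (w : seq pass) (k : nat) :
  (0 < k < size w)%N ->
  moment C (flip_arc k w) = moment C w + flip_change C k w.
Proof.
by move=> k_in; rewrite flip_arcE // moment_swap -arc_decomp.
Qed.

Lemma flip_change_apart (C : pred nat) (w : seq pass) (k l : nat) :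
  (0 < k < size w)%N -> (0 < l)%N -> apart k l ->
  flip_change C l (flip_arc k w) = flip_change C l w.
Proof.
by rewrite /flip_change /apart => ? ? ?; rewrite !pass_at_flip_arc //; lia.
Qed.

(** Along a dart the change becomes a difference between its two ends,
    with a coefficient that involves the direction of travel. Such differences
    can telescope around a face. *)
Lemma flip_change_dart (C : pred nat) (w : seq pass) (d : dart w) :
  flip_change C d.1 w =
  (if d.2 then 1 else -1)
  * label_step (pass_at w (start_pos d)) * label_step (pass_at w (tip_pos d))
  * ((C (xing (pass_at w (start_pos d))))%:R - (C (tip d))%:R).
Proof.
case: d => k b; rewrite /flip_change /start_pos /tip /tip_pos /=.
by case: b; ring.
Qed.

Lemma step_at_crossing (w : seq pass) (i : nat) : well_formed w ->
  (i < size w)%N ->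
  label_step (pass_at w i) =
  if xing (pass_at w i) \in classical_crossings w
  then (if lr (pass_at w i) then -1 else 1) else 0.
Proof.
move=> wf lt_i; rewrite /label_step; case: eqP => [vi|/eqP ci].
  by rewrite (negbTE (virtual_pass wf lt_i vi)).
by rewrite classical_pass.
Qed.

(** Write a side as a coefficient times the difference between its
    ends. A left turn determines the direction of the next side from the strand
    at the tip, and from this each coefficient is found to be minus the product
    of the directions of the three sides, if both ends are classical, and 0
    otherwise. So the three coefficients agree, and the sum telescopes, except
    when exactly two of the corners are classical. *)
Lemma flip_change_triangle (C : pred nat) (w : seq pass) (d1 d2 d3 : dart w) :
    well_formed w -> face [:: d1; d2; d3] ->
    count (mem (classical_crossings w)) [:: tip d1; tip d2; tip d3] != 2%N ->
  flip_change C d1.1 w + flip_change C d2.1 w + flip_change C d3.1 w = 0.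
Proof.
move=> wf /and3P[/= /and4P[/eqP t12 /eqP t23 /eqP t31 _]].
move=> /and4P[in1 in2 in3 _] _.
have [x12 l12 f12] := left_turn_inside wf in1 t12.
have [x23 l23 f23] := left_turn_inside wf in2 t23.
have [x31 l31 f31] := left_turn_inside wf in3 t31.
rewrite !flip_change_dart !step_at_crossing ?start_pos_lt ?tip_pos_lt //.
rewrite -!/(tip _) x12 x23 x31 l12 l23 l31.
move: f12 f23 f31.
case: (lr (pass_at w (tip_pos d1))); case: (lr (pass_at w (tip_pos d2)));
  case: (lr (pass_at w (tip_pos d3))); case: (d1.2); case: (d2.2);
  case: (d3.2) => //= _ _ _.
all: case: (tip d1 \in _); case: (tip d2 \in _); case: (tip d3 \in _) => //=.
all: by move=> _; ring.
Qed.

(** The three arcs of the triangle have disjoint ends, so the three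
    exchanges do not interfere. *)
Lemma moment_flip_triangle (C : pred nat) (w : seq pass) (d1 d2 d3 : dart w) :
    well_formed w -> face [:: d1; d2; d3] ->
    count (mem (classical_crossings w)) [:: tip d1; tip d2; tip d3] != 2%N ->
  moment C (flip_triangle d1 d2 d3) = moment C w.
Proof.
move=> wf face3 cnt; have := flip_change_triangle C wf face3 cnt.
case/and3P: face3 => /= /and4P[/eqP t12 /eqP t23 /eqP t31 _].
move=> /and4P[in1 in2 in3 _]; rewrite !inE negb_or !andbT.
move=> /andP[/andP[n12 n13] n23].
have [x12 l12 _] := left_turn_inside wf in1 t12.
have [x23 l23 _] := left_turn_inside wf in2 t23.
have [x31 l31 _] := left_turn_inside wf in3 t31.
have [n31 n32 n21] : [/\ tip d3 != tip d1, tip d3 != tip d2 & tip d2 != tip d1].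
  by rewrite eq_sym n13 eq_sym n23 eq_sym n12.
have ap12 : apart d1.1 d2.1.
  apply: (turn_apart wf in1 in2 t12); rewrite ?x31 //.
  by apply: (@pos_neq w); rewrite x31.
have ap23 : apart d2.1 d3.1.
  apply: (turn_apart wf in2 in3 t23); rewrite ?x12 //.
  by apply: (@pos_neq w); rewrite x12.
have ap31 : apart d3.1 d1.1.
  apply: (turn_apart wf in3 in1 t31); rewrite ?x23 //.
  by apply: (@pos_neq w); rewrite x23.
have apC k l : apart k l = apart l k by rewrite /apart orbC.
have [g1 g2] : (0 < d1.1)%N /\ (0 < d2.1)%N by case/andP: in1; case/andP: in2.
have in2' : (0 < d2.1 < size (flip_arc d3.1 w))%N by rewrite size_flip_arc.
have in1' : (0 < d1.1 < size (flip_arc d2.1 (flip_arc d3.1 w)))%N.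
  by rewrite size_flip_arc // size_flip_arc.
rewrite /flip_triangle (moment_flip_arc _ in1') (moment_flip_arc _ in2').
rewrite (moment_flip_arc _ in3) (flip_change_apart _ in2') // 1?apC //.
rewrite (flip_change_apart _ in3) //; last by rewrite apC.
rewrite (flip_change_apart _ in3) // => change0.
by rewrite -!addrA -[RHS]addr0 -change0; congr (_ + _); ring.
Qed.

Lemma has_flip_triangle (P : pred pass) (w : seq pass) (d1 d2 d3 : dart w) :
  (0 < d1.1 < size w)%N -> (0 < d2.1 < size w)%N -> (0 < d3.1 < size w)%N ->
  has P (flip_triangle d1 d2 d3) = has P w.
Proof.
by move=> in1 in2 in3; rewrite /flip_triangle !has_flip_arc ?size_flip_arc.
Qed.

Lemma parity_polynomial_flip_triangle (w : seq pass) (d1 d2 d3 : dart w) :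
    well_formed w -> well_formed (flip_triangle d1 d2 d3) ->
    face [:: d1; d2; d3] ->
    count (mem (classical_crossings w)) [:: tip d1; tip d2; tip d3] != 2%N ->
  parity_polynomial w = parity_polynomial (flip_triangle d1 d2 d3).
Proof.
move=> wf wf' face3 cnt; have /and3P[_ /= /and4P[in1 in2 in3 _] _] := face3.
have same_mem c : (c \in classical_crossings (flip_triangle d1 d2 d3)) =
    (c \in classical_crossings w).
  by rewrite !mem_classical_crossings has_flip_triangle.
apply: (@parity_polynomial_moment _ _ [::]) => //.
- rewrite filter_predT; apply: uniq_perm => //; exact: undup_uniq.
- move=> c; rewrite same_mem => c_in.
  by rewrite !sgn_has ?same_mem // has_flip_triangle.
- by move=> c _; apply: moment_flip_triangle.
by rewrite big_pred0.
Qed.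

(** * Kinks and bigons *)

Lemma remove_none (xs : seq nat) (u : seq pass) :
  count (fun p => xing p \in xs) u = 0%N -> remove xs u = u.
Proof.
move=> /eqP; rewrite -leqn0 leqNgt -has_count -all_predC => /all_filterP.
exact.
Qed.

Lemma remove_pair (xs : seq nat) (u v : seq pass) (p q : pass) :
  xing p \in xs -> xing q \in xs ->
  remove xs (u ++ p :: q :: v) = remove xs u ++ remove xs v.
Proof. by move=> px qx; rewrite /remove filter_cat /= px qx. Qed.

Lemma classical_pass_cat (u v : seq pass) (p : pass) : lay p != Virtual ->
  xing p \in classical_crossings (u ++ p :: v).
Proof.
move=> cp; rewrite mem_classical_crossings has_cat /= eqxx.
by rewrite [classical_layer _]cp orbT.
Qed.

Lemma opposite_steps (p q : pass) : lay p != Virtual -> lay q != Virtual ->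
  lr p = ~~ lr q ->
  label_step p + label_step q = 0 /\ label_step p * label_step q = -1.
Proof.
by rewrite /label_step => /negbTE -> /negbTE -> ->; case: lr.
Qed.

(** The moment of the crossing of a kink is -1, from the product
    of its two steps, so its weight is 0. *)
Lemma parity_polynomial_kink (w u v : seq pass) (p q : pass) :
    w = u ++ p :: q :: v ->
    well_formed w -> well_formed (remove [:: xing p] w) ->
    xing q = xing p -> lay p != Virtual -> lay q != Virtual -> lr p = ~~ lr q ->
  parity_polynomial w = parity_polynomial (remove [:: xing p] w).
Proof.
move=> wE wf wf' xq cp cq lpq; have [sum0 prod] := opposite_steps cp cq lpq.
have x_in : xing p \in classical_crossings w by rewrite wE classical_pass_cat.
have := count_passes wf (classical_crossings_sub x_in).
rewrite {1}wE count_cat /= xq eqxx => cnt.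
have mem1 p' : (xing p' \in [:: xing p]) = (xing p' == xing p) by rewrite inE.
have rmE : remove [:: xing p] w = u ++ v.
  rewrite wE remove_pair ?mem1 ?xq // !remove_none // (eq_count mem1); lia.
apply: parity_polynomial_remove => // [c c_out|].
  rewrite rmE wE moment_delete ?xq //=.
  by rewrite inE eq_sym in c_out; rewrite (negbTE c_out) mul0r addr0.
rewrite (eq_bigl (pred1 (xing p))) => [|c]; last by rewrite inE.
rewrite -big_filter filter_pred1_uniq ?undup_uniq // big_seq1.
rewrite weight_moment // [in moment _ _]wE moment_delete ?xq //= eqxx prod.
rewrite moment_none; first by rewrite add0r mul1r subrr mulr0 crossing_term0.
suff : ~~ has (fun p' => xing p' == xing p) (u ++ v) by [].
by rewrite has_cat !has_count; lia.
Qed.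

Lemma parity_polynomial_Omega1 (w : seq pass) (d : dart w) :
    well_formed w -> well_formed (remove [:: tip d] w) -> face [:: d] ->
    all_ends classical_layer [:: d] ->
  parity_polynomial w = parity_polynomial (remove [:: tip d] w).
Proof.
move=> wf wf' /and3P[/= /andP[/eqP turn _] /andP[d_in _] _].
rewrite /all_ends /= !andbT => /andP[c1 c2].
have [x l _] := left_turn_inside wf d_in turn.
have [xk1 xk] : xing (pass_at w d.1.-1) = tip d /\ xing (pass_at w d.1) = tip d.
  by move: x; rewrite /tip /start_pos; case: d.2.
have lk : lr (pass_at w d.1.-1) = ~~ lr (pass_at w d.1).
  by move: l; rewrite /tip_pos /start_pos; case: d.2 => // ->; rewrite negbK.
rewrite -xk1 in wf' *; apply: (parity_polynomial_kink (arc_decomp d_in)) => //.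
by rewrite xk xk1.
Qed.

(** The two pairs of consecutive passes contribute -1 each to
    the moment of the set of both crossings. The moments of x and y then add up
    to -2, which with opposite signs means equal weights. *)
Lemma parity_polynomial_bigon (w u v z : seq pass) (p q r s : pass)
    (x y : nat) :
    w = u ++ p :: q :: v ++ r :: s :: z ->
    well_formed w -> well_formed (remove [:: x; y] w) -> x != y ->
    perm_eq [:: xing p; xing q] [:: x; y] ->
    perm_eq [:: xing r; xing s] [:: x; y] ->
    x \in classical_crossings w -> y \in classical_crossings w ->
    sgn w x = - sgn w y ->
    lay p != Virtual -> lay q != Virtual -> lr p = ~~ lr q ->
    lay r != Virtual -> lay s != Virtual -> lr r = ~~ lr s ->
  parity_polynomial w = parity_polynomial (remove [:: x; y] w).
Proof.
move=> wE wf wf' xy pq_xy rs_xy x_in y_in sgn_xy cp cq lpq cr cs lrs.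
have [sum0 prod] := opposite_steps cp cq lpq.
have [sum0' prod'] := opposite_steps cr cs lrs.
have in_xy (e : nat) : (e \in [:: x; y]) = (e == x) || (e == y) by rewrite !inE.
have [pin qin] : xing p \in [:: x; y] /\ xing q \in [:: x; y].
  by rewrite -!(perm_mem pq_xy) !inE !eqxx orbT.
have [rin sin] : xing r \in [:: x; y] /\ xing s \in [:: x; y].
  by rewrite -!(perm_mem rs_xy) !inE !eqxx orbT.
have cnt_all : count (fun p => xing p \in [:: x; y]) w = 4%N.
  have := count_predUI (fun p => xing p == x) (fun p => xing p == y) w.
  rewrite (count_passes wf (classical_crossings_sub x_in)).
  rewrite (count_passes wf (classical_crossings_sub y_in)).
  rewrite [X in (_ + X)%N](eq_count (a2 := pred0)).
    rewrite count_pred0 addn0 => /(etrans _); apply.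
    by apply: eq_count => p' /=; apply: in_xy.
  move=> p' /=; apply/negP => /andP[/eqP -> /eqP xye].
  by rewrite xye eqxx in xy.
rewrite wE count_cat /= count_cat /= pin qin rin sin in cnt_all.
have [nu nv nz] : [/\ count (fun p => xing p \in [:: x; y]) u = 0,
    count (fun p => xing p \in [:: x; y]) v = 0
  & count (fun p => xing p \in [:: x; y]) z = 0]%N.
  move: (count _ u) (count _ v) (count _ z) cnt_all; clear=> a b c h.
  by split; lia.
have rmE : remove [:: x; y] w = u ++ v ++ z.
  rewrite wE (remove_pair _ _ pin qin) (remove_pair _ _ rin sin).
  by rewrite !remove_none.
have delete (C : pred nat) :
   C (xing p) = C (xing q) -> C (xing r) = C (xing s) ->
   moment C w = moment C (u ++ v ++ z) - (C (xing p))%:R - (C (xing r))%:R.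
  move=> Cpq Crs; rewrite wE moment_delete // catA moment_delete // prod prod'.
  by rewrite -catA; ring.
apply: parity_polynomial_remove => // [c c_out|].
  have no e : e \in [:: x; y] -> pred1 c e = false.
    by move=> e_in; apply: contraNF c_out => /eqP <-.
  by rewrite rmE delete !no // !subr0.
rewrite -big_filter (perm_big [:: x; y]) /=; last first.
  apply: uniq_perm; rewrite ?filter_uniq ?undup_uniq //= ?inE ?xy // => e.
  rewrite mem_filter; case: (boolP (e \in _)) => //.
  by rewrite !inE => /orP[] /eqP ->; rewrite ?x_in ?y_in.
have := delete (mem [:: x; y]); rewrite /= pin qin rin sin => /(_ erefl erefl).
rewrite (_ : moment _ (u ++ _) = 0); last first.
  apply: moment_none.
  suff : ~~ has (fun p' => xing p' \in [:: x; y]) (u ++ v ++ z) by [].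
  by rewrite !has_cat !has_count nu nv nz.
rewrite (_ : moment _ w = moment (pred1 x) w + moment (pred1 y) w); last first.
  rewrite -momentU; last first.
    move=> e /=; apply/negP => /andP[/eqP -> /eqP xye].
    by rewrite xye eqxx in xy.
  by apply: eq_bigl => j; rewrite /= !inE.
rewrite big_cons big_seq1 !weight_moment // sgn_xy crossing_term_opp => mom.
rewrite (_ : - - sgn w y * (1 + moment (pred1 x) w) =
             - sgn w y * (1 + moment (pred1 y) w)) ?addNr //.
rewrite (_ : moment (pred1 x) w = - 2 - moment (pred1 y) w); first by ring.
by apply: (addIr (moment (pred1 y) w)); rewrite mom subrK.
Qed.

(** The condition on a side of the bigon that does not depend on which side
    is traversed first by the strand, nor on which of them is on top. *)
Definition bigon_side (w : seq pass) (x y k : nat) : Prop :=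
  [/\ perm_eq [:: xing (pass_at w k.-1); xing (pass_at w k)] [:: x; y],
      lay (pass_at w k.-1) != Virtual, lay (pass_at w k) != Virtual
    & lr (pass_at w k.-1) = ~~ lr (pass_at w k)].

Lemma parity_polynomial_bigon_sides (w : seq pass) (x y k l : nat) :
    well_formed w -> well_formed (remove [:: x; y] w) -> x != y ->
    x \in classical_crossings w -> y \in classical_crossings w ->
    sgn w x = - sgn w y ->
    (0 < k < size w)%N -> (0 < l < size w)%N -> apart k l ->
    bigon_side w x y k -> bigon_side w x y l ->
  parity_polynomial w = parity_polynomial (remove [:: x; y] w).
Proof.
move=> wf wf' xy x_in y_in sgn_xy.
wlog lt_kl : k l / (k.+1 < l)%N => [gen|].
  move=> k_in l_in ap side_k side_l; case/orP: (ap) => lt_kl.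
    exact: (gen k l).
  by apply: (gen l k) => //; rewrite /apart orbC.
move=> /andP[k_gt0 _] /andP[_ lt_l] _ [pk ck1 ck lk] [pl cl1 cl ll].
have [u [v [z wE]]] := two_arcs_decomp k_gt0 lt_kl lt_l.
exact: (parity_polynomial_bigon wE).
Qed.

Lemma dart_side (w : seq pass) (x y : nat) (d : dart w) :
    perm_eq [:: xing (pass_at w (start_pos d)); tip d] [:: x; y] ->
    lay (pass_at w (start_pos d)) != Virtual ->
    lay (pass_at w (tip_pos d)) != Virtual ->
    lr (pass_at w (start_pos d)) = ~~ lr (pass_at w (tip_pos d)) ->
  bigon_side w x y d.1.
Proof.
rewrite /tip /tip_pos /start_pos; case: d => k [] //= pe cs ct l; split=> //.
  by rewrite (perm_catC [:: _] [:: _]).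
by rewrite l negbK.
Qed.

(** The top side passes over the bottom strand at both its ends, and
    the left turns force it to do so from opposite sides, which gives the two
    crossings opposite signs. *)
Lemma parity_polynomial_Omega2 (w : seq pass) (d1 d2 : dart w) :
    well_formed w -> well_formed (remove [:: tip d1; tip d2] w) ->
    face [:: d1; d2] -> all_ends over_layer [:: d1] ->
  parity_polynomial w = parity_polynomial (remove [:: tip d1; tip d2] w).
Proof.
move=> wf wf' /and3P[/= /and3P[/eqP t12 /eqP t21 _] /and3P[in1 in2 _]].
rewrite inE andbT => xy; rewrite /all_ends /= !andbT => /andP[/eqP o1' /eqP o1].
have [x12 l12 f12] := left_turn_inside wf in1 t12.
have [x21 l21 f21] := left_turn_inside wf in2 t21.
have os : lay (pass_at w (start_pos d1)) = Over.
  by rewrite /start_pos; case: d1.2.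
have ot : lay (pass_at w (tip_pos d1)) = Over by rewrite /tip_pos; case: d1.2.
have lt_t1 := tip_pos_lt in1; have lt_s1 := start_pos_lt in1.
have lt_t2 := tip_pos_lt in2; have lt_s2 := start_pos_lt in2.
have x_in : tip d1 \in classical_crossings w.
  by apply: classical_pass; rewrite ?ot.
have y_in : tip d2 \in classical_crossings w.
  by rewrite -x21; apply: classical_pass; rewrite ?os.
have llr : lr (pass_at w (tip_pos d1)) = lr (pass_at w (tip_pos d2)).
  by move: f12 f21; case: d1.2; case: d2.2; case: lr; case: lr.
have lr1 : lr (pass_at w (start_pos d1)) = ~~ lr (pass_at w (tip_pos d1)).
  by rewrite l21 llr.
have lr2 : lr (pass_at w (start_pos d2)) = ~~ lr (pass_at w (tip_pos d2)).
  by rewrite l12 llr.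
have classical i : (i < size w)%N ->
    xing (pass_at w i) \in classical_crossings w ->
    lay (pass_at w i) != Virtual.
  by move=> lt_i; apply: contraL => /eqP; apply: virtual_pass.
have over_x : over_pos w (tip d1) = tip_pos d1.
  by apply: find_unique => //; rewrite ?count_layer // ot !eqxx.
have over_y : over_pos w (tip d2) = start_pos d1.
  by apply: find_unique => //; rewrite ?count_layer // x21 os !eqxx.
apply: (@parity_polynomial_bigon_sides w _ _ d1.1 d2.1) => //.
- have := step_over wf x_in; have := step_over wf y_in.
  rewrite over_x over_y => sy sx.
  have [|| /eqP + _] := @opposite_steps _ _ _ _ lr1; rewrite ?os ?ot // sx sy.
  by rewrite addr_eq0 opprK => /eqP <-.
- apply: (turn_apart wf in1 in2 t12); rewrite ?x21 ?[tip d2 == _]eq_sym //.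
  by rewrite eq_sym (lr_pos_neq l21).
- apply: dart_side; rewrite ?os ?ot // x21.
  by rewrite (perm_catC [:: _] [:: _]).
apply: dart_side => //; last 2 first.
- by apply: classical; rewrite // x12.
- exact: classical.
by rewrite x12.
Qed.

(** * Invariance *)

Lemma renamed_crossings (f : nat -> nat) (w : seq pass) : injective f ->
  classical_crossings (rename f w) = map f (classical_crossings w).
Proof.
move=> f_inj; rewrite /classical_crossings /rename filter_map -map_comp.
by rewrite -(undup_map_inj f_inj) -map_comp.
Qed.

Lemma moment_rename (f : nat -> nat) (w : seq pass) (c : nat) : injective f ->
  moment (pred1 (f c)) (rename f w) = moment (pred1 c) w.
Proof.
move=> f_inj; rewrite /moment size_map.
have pass_f (j : 'I_(size w)) : pass_at (rename f w) j =
    Pass (f (xing (pass_at w j))) (lr (pass_at w j)) (lay (pass_at w j)).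
  by rewrite /pass_at (nth_map (Pass 0 true Virtual)).
apply: eq_big => j; rewrite pass_f /= ?inj_eq // => _.
by congr (_ * _); rewrite /label -map_take big_map.
Qed.

Lemma parity_polynomial_rename (f : nat -> nat) (w : seq pass) : injective f ->
  well_formed w -> well_formed (rename f w) ->
  parity_polynomial w = parity_polynomial (rename f w).
Proof.
move=> f_inj wf wf'; rewrite !parity_polynomialE // renamed_crossings //.
rewrite big_map.
rewrite !big_seq; apply: eq_bigr => c c_in.
have fc_in : f c \in classical_crossings (rename f w).
  by rewrite renamed_crossings // map_f.
have sgn_f : sgn (rename f w) (f c) = sgn w c.
  rewrite !sgn_has // has_map; congr (if _ then _ else _).
  by apply: eq_has => p /=; rewrite inj_eq.
by rewrite !weight_moment // sgn_f moment_rename.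
Qed.

(** In the mixed third move the two ends of the moving strand are
    virtual, so at most one of the corners of the triangle is classical. *)
Lemma parity_polynomial_move (w w' : seq pass) : move w w' ->
  well_formed w -> well_formed w' -> parity_polynomial w = parity_polynomial w'.
Proof.
case=> {w'}.
- by move=> f f_inj; apply: parity_polynomial_rename.
- by move=> d face1 cl wf wf'; apply: parity_polynomial_Omega1.
- by move=> d1 d2 face2 ov wf wf'; apply: parity_polynomial_Omega2.
- move=> d1 d2 d3 face3 cl _ wf wf'.
  apply: parity_polynomial_flip_triangle => //.
  have /and3P[_ /= /and4P[in1 in2 in3 _] _] := face3.
  have tip_in (d : dart w) :
      (0 < d.1 < size w)%N -> all_ends classical_layer [:: d] ->
      tip d \in classical_crossings w.
    move=> d_in; rewrite /all_ends /= !andbT => /andP[c1 c2].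
    apply: classical_pass; first exact: tip_pos_lt.
    by case: d.2.
  move: cl; rewrite /all_ends /= => /and4P[cl1 cl2 cl3 _].
  by rewrite !tip_in // /all_ends /= andbT.
- move=> d face1 vl wf wf'; apply: parity_polynomial_remove_virtual => // x.
  have /and3P[_ /= /andP[d_in _] _] := face1.
  by rewrite inE => /eqP ->; case: (virtual_dart wf d_in vl).
- move=> d1 d2 face2 vl wf wf'; apply: parity_polynomial_remove_virtual => // x.
  have /and3P[_ /= /and3P[in1 in2 _] _] := face2.
  move: vl; rewrite /all_ends /= => /and3P[vl1 vl2 _].
  have [] := virtual_dart wf in1; first by rewrite /all_ends /= andbT.
  have [] := virtual_dart wf in2; first by rewrite /all_ends /= andbT.
  by move=> v2 _ v1 _; rewrite !inE => /orP[] /eqP ->.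
- move=> d1 d2 d3 face3 vl wf wf'; apply: parity_polynomial_flip_triangle => //.
  have /and3P[_ /= /and4P[in1 in2 in3 _] _] := face3.
  move: vl; rewrite /all_ends /= => /and4P[vl1 vl2 vl3 _].
  have [|/negbTE -> _] := virtual_dart wf in1.
    by rewrite /all_ends /= andbT.
  have [|/negbTE -> _] := virtual_dart wf in2.
    by rewrite /all_ends /= andbT.
  have [|/negbTE -> _] // := virtual_dart wf in3.
  by rewrite /all_ends /= andbT.
- move=> d1 d2 d3 face3 vl _ wf wf'.
  apply: parity_polynomial_flip_triangle => //.
  have /and3P[/= /and4P[_ _ /eqP t31 _] /and4P[in1 in2 in3 _] _] := face3.
  have [x31 _ _] := left_turn_inside wf in3 t31.
  have [/negbTE -> ] := virtual_dart wf in1 vl; rewrite x31 => /negbTE ->.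
  by case: (_ \in _).
- move=> gt0 v wf wf'; apply: parity_polynomial_remove_virtual => // x.
  by rewrite inE => /eqP ->; apply: virtual_pass.
move=> gt0 v wf wf'; apply: parity_polynomial_remove_virtual => // x.
by rewrite inE => /eqP ->; apply: virtual_pass => //; rewrite prednK.
Qed.

Lemma parity_polynomial_equivalent (D D' : diagram) : equivalent D D' ->
  parity_polynomial D = parity_polynomial D'.
Proof.
elim=> {D D'} [D D' DD'|D|D D' _ -> //|D D' D'' _ -> _ -> //]; last by [].
by apply: parity_polynomial_move => //; apply: diagram_well_formed.
Qed.

Theorem theorem2p1 (K : virtual_knotoid) (D D' : diagram)
    (hD : represents K D) (hD' : represents K D') :
  parity_polynomial D = parity_polynomial D'.
Proof.
have [D0 class] := represents_class K.
have /parity_polynomial_equivalent <- := (class D).1 hD.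
exact/parity_polynomial_equivalent/(class D').1.
Qed.
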